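(* For every polynomial $p(\cdot)$ there is a frame matroid $M$ with the following property: for every set $\mathcal{A}$ of subsets of $E(M)$ with $|\mathcal{A}|\leq p(|E(M)|)$ there is a quasi-graphic matroid $M'$ that is not a frame matroid, such that $E(M')=E(M)$ and $r_{M'}(A)=r_M(A)$ for each $A\in\mathcal{A}$.
   Context: All matroids are finite. For a graph $G$ and a vertex $v$, $\mathrm{loops}_G(v)$ denotes the set of loop-edges of $G$ at $v$, and $E(G-v)$ is the set of edges of $G$ not incident with $v$. A graph $G$ is a framework for a matroid $M$ if (1) $E(G)=E(M)$; (2) $r_M(E(H))\leq |V(H)|$ for each component $H$ of $G$; and (3) for each vertex $v$ of $G$, $\mathrm{cl}_M(E(G-v))\subseteq E(G-v)\cup \mathrm{loops}_G(v)$. A matroid is quasi-graphic if it has a framework. A matroid $M$ is framed if it has a basis $V$ such that for each element $e\in E(M)$ there is a subset $W\subseteq V$ with $|W|\le 2$ and $e\in\mathrm{cl}_M(W)$; a frame matroid is a restriction of a framed matroid. *)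

(* Defs.v *)
From mathcomp Require Import all_boot all_order all_algebra.

Set Implicit Arguments.
Unset Strict Implicit.
Unset Printing Implicit Defensive.

(* A matroid whose ground set E(M) is the whole finite type E; two matroids
   have the same ground set when they have the same type [matroid E]. *)
Record matroid (E : finType) := Matroid {
  indep : {pred {set E}};
  indep0 : set0 \in indep;
  indepS : forall I J : {set E}, J \subset I -> I \in indep -> J \in indep;
  indep_aug : forall I J : {set E}, I \in indep -> J \in indep ->
    #|I| < #|J| -> exists2 x, x \in J :\: I & x |: I \in indep }.

Section MatroidNotions.
Variables (E : finType) (M : matroid E).

Definition rank (A : {set E}) : nat :=
  \max_(I : {set E} | (I \subset A) && (I \in indep M)) #|I|.

Definition cl (A : {set E}) : {set E} := [set x | rank (x |: A) == rank A].

Definition is_basis (B : {set E}) : bool := maxset (indep M) B.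

Definition framed : Prop :=
  exists2 V : {set E}, is_basis V &
    forall e : E, exists W : {set E}, [/\ W \subset V, #|W| <= 2 & e \in cl W].

End MatroidNotions.

(* M is, up to the relabelling f of its elements, the restriction of N to the
   image of f. *)
Definition restriction_via (E F : finType) (M : matroid E) (N : matroid F)
    (f : E -> F) : Prop :=
  injective f /\ forall A : {set E}, (A \in indep M) = (f @: A \in indep N).

Definition frame_matroid (E : finType) (M : matroid E) : Prop :=
  exists (F : finType) (N : matroid F) (f : E -> F),
    framed N /\ restriction_via M N f.

(* A finite graph, with loops and parallel edges allowed, whose edge set is E. *)
Record graph (E : finType) := Graph {
  vertex : finType;
  ends : E -> {set vertex};
  card_ends : forall e, 0 < #|ends e| <= 2 }.

Section GraphNotions.
Variables (E : finType) (G : graph E).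

Definition adj : rel (vertex G) := fun u v => [exists e, ends G e == [set u; v]].

(* V(H) and E(H) for the component H of G that contains v; every component
   arises from some v. *)
Definition comp_vertices (v : vertex G) : {set vertex G} :=
  [set w | connect adj v w].

Definition comp_edges (v : vertex G) : {set E} :=
  [set e | ends G e \subset comp_vertices v].

Definition del_edges (v : vertex G) : {set E} := [set e | v \notin ends G e].

Definition loops (v : vertex G) : {set E} := [set e | ends G e == [set v]].

End GraphNotions.

(* E(G) = E(M) is enforced by the types. Exactly these conditions define a
   framework here: there is no further condition on the number of components of
   G[C] for a circuit C, so disconnected frameworks are quite permissive. *)
Definition framework (E : finType) (M : matroid E) (G : graph E) : Prop :=
  (forall v : vertex G, rank M (comp_edges v) <= #|comp_vertices v|) /\
  (forall v : vertex G, cl M (del_edges v) \subset del_edges v :|: loops v).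

Definition quasi_graphic (E : finType) (M : matroid E) : Prop :=
  exists G : graph E, framework M G.

(* Main.v *)
Require Import Defs.
From mathcomp Require Import all_boot all_order all_algebra.
From mathcomp Require Import zify.
Import Order.TTheory GRing.Theory Num.Theory.

(* M is the bicircular matroid of a cyclic prism: n fibres of two vertices, the
   two vertices of a fibre joined by four rungs, and all four crosses between
   consecutive fibres. Choosing one vertex x(i) in each fibre gives two disjoint
   induced cycles, through the chosen vertices and through the others; their
   union B is a basis of M, and B - f + e is a basis for all f in B and e not in
   B. Hence declaring B dependent gives a matroid M' whose rank function differs
   from that of M at B only. There are 2^(n-1) such bases, more than p(|E|) for
   large n, so some choice escapes the given family.

   M' is not a frame matroid: a line with four points lies in the span of only
   two joints, so the rungs identify the fibres with disjoint pairs of joints,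
   and the rank of sets containing rungs shows that crosses meeting at a vertex
   share a joint. Then each of the two cycles spans its n joints, so their
   union B has rank 2n, whereas it has rank less than 2n in M'. *)

Set Implicit Arguments.
Unset Strict Implicit.
Unset Printing Implicit Defensive.

(** * Rank in a matroid: submodularity and absorption of elements *)

Section RankTheory.
Variables (E : finType) (M : matroid E).
Implicit Types (X Y I J : {set E}) (e : E).

Lemma indep_rank I X : I \in indep M -> I \subset X -> #|I| <= rank M X.
Proof. by move=> iI sIX; apply: leq_bigmax_cond; rewrite sIX. Qed.

Lemma rank_witness X :
  exists I : {set E}, [/\ I \subset X, I \in indep M & #|I| = rank M X].
Proof.
have P0 : (set0 \subset X) && (set0 \in indep M) by rewrite sub0set indep0.
have /(eq_bigmax_cond (fun I : {set E} => #|I|)) :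
  0 < #|[pred I : {set E} | (I \subset X) && (I \in indep M)]|.
  by apply/card_gt0P; exists set0.
by case=> I /andP[sIX iI] rE; exists I; split.
Qed.

Lemma rank_leP X k :
  reflect (forall I : {set E}, I \subset X -> I \in indep M -> #|I| <= k)
          (rank M X <= k).
Proof.
apply: (iffP (bigmax_leqP _ _ _)) => H I; first by move=> ? ?; apply: H; apply/andP.
by case/andP; apply: H.
Qed.

Lemma rank_mono X Y : X \subset Y -> rank M X <= rank M Y.
Proof.
move=> sXY; apply/rank_leP => I sIX iI; apply: indep_rank => //.
exact: subset_trans sXY.
Qed.

Lemma rank_card X : rank M X <= #|X|.
Proof. by apply/rank_leP => I sIX _; apply: subset_leq_card. Qed.

Lemma rank_indep I : I \in indep M -> rank M I = #|I|.
Proof. by move=> iI; apply/eqP; rewrite eqn_leq rank_card indep_rank. Qed.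

Lemma indep_extend I X : I \subset X -> I \in indep M ->
  exists J : {set E}, [/\ I \subset J, J \subset X, J \in indep M & #|J| = rank M X].
Proof.
move=> sIX iI; have [n le_n] := ubnP (rank M X - #|I|).
elim: n I sIX iI le_n => // n IHn I sIX iI le_n.
have := indep_rank iI sIX; rewrite leq_eqVlt => /orP[/eqP eI|lt_I].
  by exists I; split.
have [J [sJX iJ eJ]] := rank_witness X; rewrite -eJ in lt_I.
have [x /setDP[xJ xI] iIx] := indep_aug iI iJ lt_I.
have sIxX : x |: I \subset X by rewrite subUset sub1set (subsetP sJX).
case: (IHn _ sIxX iIx) => [|K [sIK sKX iK eK]]; first by rewrite cardsU1 xI; lia.
by exists K; split=> //; apply: subset_trans sIK; apply: subsetUr.
Qed.

(** Extend a maximal independent subset [I] of the intersection to one [K] of the union, and count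
    [K] within [X] and within [Y]. *)
Lemma rank_submod X Y :
  rank M (X :|: Y) + rank M (X :&: Y) <= rank M X + rank M Y.
Proof.
have [I [sI iI <-]] := rank_witness (X :&: Y).
have sIU : I \subset X :|: Y.
  by apply: subset_trans sI _; apply: subset_trans (subsetIl _ _) (subsetUl _ _).
have [K [sIK sK iK <-]] := indep_extend sIU iI.
have iKZ Z : K :&: Z \in indep M := indepS (subsetIl K Z) iK.
apply: leq_trans (leq_add (indep_rank (iKZ X) (subsetIr _ _))
                          (indep_rank (iKZ Y) (subsetIr _ _))).
rewrite -(cardsUI (K :&: X)) -setIUr (setIidPl sK) leq_add2l setIACA setIid.
by apply: subset_leq_card; rewrite subsetI sIK.
Qed.

Lemma rank_absorbE e X : (rank M (e |: X) == rank M X) = (rank M (e |: X) <= rank M X).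
Proof. by rewrite eqn_leq andbC rank_mono ?subsetUr. Qed.

Lemma rank_absorb X Y :
  (forall y, y \in Y -> rank M (y |: X) = rank M X) -> rank M (X :|: Y) = rank M X.
Proof.
move=> absY; apply/eqP; rewrite eqn_leq andbC rank_mono ?subsetUl //= leqNgt.
apply/negP; have [I [sIX iI eI]] := rank_witness X.
have [J [sJ iJ <-]] := rank_witness (X :|: Y); rewrite -{1}eI => /(indep_aug iI iJ).
case=> x /setDP[xJ xI] /indep_rank/(_ (setUS [set x] sIX)).
rewrite cardsU1 xI eI ltnNge => /negP; apply.
have /setUP[xX|/absY->//] := subsetP sJ _ xJ.
by rewrite (setUidPr _) ?sub1set.
Qed.

(** Submodularity for [e |: X] and [Y], whose intersection contains [X]. *)
Lemma rank_absorb_mono e X Y : X \subset Y ->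
  rank M (e |: X) = rank M X -> rank M (e |: Y) = rank M Y.
Proof.
move=> sXY eX; apply/eqP; rewrite rank_absorbE.
have := rank_submod (e |: X) Y; rewrite eX -setUA (setUidPr sXY).
have : rank M X <= rank M ((e |: X) :&: Y).
  by apply: rank_mono; rewrite subsetI sXY subsetUr.
lia.
Qed.

End RankTheory.

(** * Supports of sets of elements *)

Definition supp (E V : finType) (S : E -> {set V}) (X : {set E}) : {set V} :=
  \bigcup_(e in X) S e.

Section Supp.
Variables (E V : finType) (S : E -> {set V}).
Implicit Types (X Y : {set E}) (e : E).

Lemma mem_supp e X : e \in X -> S e \subset supp S X.
Proof. by move=> eX; apply: (bigcup_sup e). Qed.

Lemma suppS X Y : X \subset Y -> supp S X \subset supp S Y.
Proof.
by move=> sXY; apply/bigcupsP => e eX; apply: mem_supp; apply: subsetP eX.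
Qed.

Lemma suppU X Y : supp S (X :|: Y) = supp S X :|: supp S Y.
Proof. by rewrite /supp bigcup_setU. Qed.

Lemma supp1 e : supp S [set e] = S e.
Proof. by rewrite /supp big_set1. Qed.

Lemma suppU1 e X : supp S (e |: X) = S e :|: supp S X.
Proof. by rewrite suppU supp1. Qed.

End Supp.

Lemma supp_imset (E F V : finType) (S : F -> {set V}) (f : E -> F) (X : {set E}) :
  supp S (f @: X) = supp (S \o f) X.
Proof.
apply/eqP; rewrite eqEsubset; apply/andP; split; apply/bigcupsP => e.
  by case/imsetP=> x xX ->; apply: (mem_supp (S \o f)).
by move=> eX; apply: (mem_supp S (imset_f f eX)).
Qed.

Lemma subset_imset (E F : finType) (f : E -> F) (X : {set E}) (I : {set F}) :
  I \subset f @: X -> exists2 J : {set E}, J \subset X & I = f @: J.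
Proof.
move=> sI; exists (f @^-1: I :&: X); first exact: subsetIr.
apply/setP=> y; apply/idP/imsetP => [yI|[x /setIP[/[!inE] ? _] ->//]].
have /imsetP[x xX ey] := subsetP sI _ yI; exists x => //.
by rewrite !inE -ey yI.
Qed.

(** * Joints of a framed matroid and the supports they induce *)

Section FramedSupport.
Variables (F : finType) (N : matroid F) (D : {set F}).
Hypotheses (indepD : D \in indep N)
  (frameD : forall e : F, exists W : {set F}, [/\ W \subset D, #|W| <= 2 & e \in cl N W]).
Implicit Types (X Y U W : {set F}) (e : F).

Let rankD U : U \subset D -> rank N U = #|U|.
Proof. by move=> sUD; apply: rank_indep; apply: indepS indepD. Qed.

(** Submodularity for [e |: U] and [e |: W]: sets of joints have rank equal to size, which leaves no
    room for [e] to raise the rank of [U :&: W]. *)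
Lemma joint_span_cap e U W : U \subset D -> W \subset D ->
  e \in cl N U -> e \in cl N W -> e \in cl N (U :&: W).
Proof.
move=> sU sW; rewrite !inE => /eqP eU /eqP eW; apply/eqP/eqP.
rewrite rank_absorbE.
have sUW : U :&: W \subset D by apply: subset_trans sU; apply: subsetIl.
have sUUW : U :|: W \subset D by rewrite subUset sU.
have := rank_submod N (e |: U) (e |: W).
rewrite eU eW (rankD sU) (rankD sW) -setUIr -cardsUI (rankD sUW).
have : rank N (U :|: W) <= rank N (e |: U :|: (e |: W)).
  by apply: rank_mono; apply: setUSS; apply: subsetUr.
by rewrite rankD //; lia.
Qed.

(** A smallest set of joints spanning [e] is also least, because such sets are closed under
    intersection. *)
Lemma joint_support : exists S : F -> {set F}, forall e,
  [/\ S e \subset D, #|S e| <= 2, e \in cl N (S e)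
    & forall U, U \subset D -> e \in cl N U -> S e \subset U].
Proof.
apply: (@fin_all_exists _ _ (fun e (T : {set F}) =>
  [/\ T \subset D, #|T| <= 2, e \in cl N T
    & forall U, U \subset D -> e \in cl N U -> T \subset U])) => e.
have [W [sWD W2 eW]] := frameD e.
pose P := [pred T : {set F} | (T \subset D) && (e \in cl N T)].
have PW : P W by rewrite /= sWD.
case: (arg_minnP (fun T : {set F} => #|T|) PW) => T /andP[sTD eT] minT.
exists T; split=> // [|U sUD eU]; first by apply: leq_trans (minT _ PW) W2.
have: #|T| <= #|T :&: U|.
  by apply: minT; rewrite /= joint_span_cap // (subset_trans (subsetIl T U)).
by move=> le_T; apply/setIidPl/eqP; rewrite eqEcard subsetIl.
Qed.

End FramedSupport.

(* What survives restriction when S e is the least set of joints spanning e. *)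
Definition frame_support (E V : finType) (M : matroid E) (S : E -> {set V}) :=
  [/\ forall e, #|S e| <= 2,
     forall X, rank M X <= #|supp S X|,
     forall e X, rank M (e |: X) = rank M X -> S e \subset supp S X
   & forall X Y, #|supp S X| <= rank M X -> #|supp S Y| <= rank M Y ->
       #|supp S (X :|: Y)| <= rank M (X :|: Y)].

Lemma framed_frame_support (F : finType) (N : matroid F) :
  framed N -> exists S : F -> {set F}, frame_support N S.
Proof.
case=> D /maxsetp indepD frameD; have [S HS] := joint_support indepD frameD.
have sSD X : supp S X \subset D by apply/bigcupsP => e _; case: (HS e).
have rS X : rank N (supp S X) = #|supp S X|.
  by apply: rank_indep; apply: indepS indepD.
have absX X (Z : {set F}) : supp S X \subset Z -> rank N (Z :|: X) = rank N Z.
  move=> sXZ; apply: rank_absorb => e eX; have [_ _ /[!inE]/eqP eS _] := HS e.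
  by apply: rank_absorb_mono eS; apply: subset_trans sXZ; apply: mem_supp.
have le_supp X : rank N X <= #|supp S X|.
  by rewrite -rS -(absX X (supp S X)) // rank_mono ?subsetUr.
(* A set whose rank reaches the size of its support spans every joint there; this yields the clause
   on unions. *)
have satX X s : #|supp S X| <= rank N X -> s \in supp S X ->
    rank N (s |: X) = rank N X.
  move=> le_X sX; apply/eqP; rewrite rank_absorbE.
  apply: leq_trans le_X; rewrite -rS -(absX X (supp S X)) //.
  by apply: rank_mono; apply: setSU; rewrite sub1set.
exists S; split=> // [e|e X eX|X Y sX sY]; first by case: (HS e).
  have [_ _ _ ->//] := HS e; rewrite inE.
  have := rank_absorb_mono (subsetUr (supp S X) X) eX.
  rewrite (absX X (supp S X)) // => eZ; rewrite rank_absorbE -eZ.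
  by apply: rank_mono; apply: setUS; apply: subsetUl.
rewrite -rS -(@rank_absorb _ N (X :|: Y) (supp S (X :|: Y))).
  by apply: rank_mono; apply: subsetUr.
move=> s; rewrite suppU => /setUP[] sS.
  by apply: (rank_absorb_mono (subsetUl X Y)); apply: satX.
by apply: (rank_absorb_mono (subsetUr X Y)); apply: satX.
Qed.

Lemma restriction_rank (E F : finType) (M : matroid E) (N : matroid F) (f : E -> F)
  (X : {set E}) : restriction_via M N f -> rank N (f @: X) = rank M X.
Proof.
case=> injf HM; apply/eqP; rewrite eqn_leq; apply/andP; split; apply/rank_leP => I sI iI.
  have [J sJX eI] := subset_imset sI.
  by rewrite eI card_imset //; apply: indep_rank; rewrite // HM -eI.
by rewrite -(card_imset _ injf); apply: indep_rank; rewrite -?HM // imsetS.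
Qed.

Lemma frame_matroid_support (E : finType) (M : matroid E) : frame_matroid M ->
  exists (V : finType) (S : E -> {set V}), frame_support M S.
Proof.
case=> F [N [f [/framed_frame_support[S [S2 Sr Sa Su]] NM]]]; exists F, (S \o f).
have rE := restriction_rank _ NM; have sE X := esym (supp_imset S f X).
split=> [e|X|e X|X Y]; rewrite ?sE -?rE //; first exact: S2.
  by rewrite imsetU1; apply: Sa.
by rewrite imsetU; apply: Su.
Qed.

(** * Transversal matroids via Hall's condition *)

Section HallMatroid.
Variables (E V : finType) (S : E -> {set V}).
Implicit Types (I J T X : {set E}) (e : E).

(** Hall's condition replaces an explicit system of distinct representatives. With [S] the ends of
    edges this is the bicircular matroid. *)
Definition hall_indep : {pred {set E}} :=
  [pred I : {set E} | [forall J : {set E}, (J \subset I) ==> (#|J| <= #|supp S J|)]].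

Lemma hall_indepP I :
  reflect (forall J, J \subset I -> #|J| <= #|supp S J|) (I \in hall_indep).
Proof.
by apply: (iffP forallP) => H J; [apply/implyP: (H J) | apply/implyP; apply: H].
Qed.

Lemma hall_indep0 : set0 \in hall_indep.
Proof. by apply/hall_indepP => J; rewrite subset0 => /eqP->; rewrite cards0. Qed.

Lemma hall_indepS I J : J \subset I -> I \in hall_indep -> J \in hall_indep.
Proof.
by move=> sJI /hall_indepP iI; apply/hall_indepP => K sKJ; apply: iI; apply: subset_trans sJI.
Qed.

(* Subsets of I with equality in Hall's condition are closed under union; if no
   element of J could be added to I, their union T would have its support
   contain that of J \ I, and T would be too small for J. *)
Lemma hall_indep_aug I J : I \in hall_indep -> J \in hall_indep ->
  #|I| < #|J| -> exists2 x, x \in J :\: I & x |: I \in hall_indep.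
Proof.
move=> /hall_indepP iI /hall_indepP iJ lt_IJ.
case: (boolP [exists x in J :\: I, x |: I \in hall_indep]) => [/exists_inP//|].
rewrite negb_exists_in => /forall_inP stuck.
pose tight T := (T \subset I) && (#|supp S T| <= #|T|).
have tightU T1 T2 : tight T1 -> tight T2 -> tight (T1 :|: T2).
  case/andP=> s1 t1 /andP[s2 t2]; rewrite /tight subUset s1 s2 suppU /=.
  have sI : T1 :&: T2 \subset I by apply: subset_trans (subsetIl _ _) s1.
  have := iI _ sI; have : #|supp S (T1 :&: T2)| <= #|supp S T1 :&: supp S T2|.
    by apply: subset_leq_card; rewrite subsetI !suppS ?subsetIl ?subsetIr.
  have := cardsUI (supp S T1) (supp S T2); have := cardsUI T1 T2; lia.
pose T := \bigcup_(K | tight K) K.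
have /andP[sTI tT] : tight T.
  by apply: (big_ind tight) => //; rewrite /tight sub0set /supp big_set0 cards0.
(* A set [K] violating Hall's condition in [x |: I] contains [x], and [K :\ x] is then tight with
   [S x] inside its support. *)
have newS x : x \in J :\: I -> S x \subset supp S T.
  move=> xJI; move: (stuck x xJI); have /setDP[_ xI] := xJI.
  case/forallPn => K; rewrite negb_imply -ltnNge => /andP[sK ltK].
  have xK : x \in K.
    apply: contraLR ltK => xK; rewrite -leqNgt; apply: iI.
    by apply/subsetP=> y yK; have /setU1P[eyx|//] := subsetP sK y yK; rewrite -eyx yK in xK.
  have sDI : K :\ x \subset I by rewrite subDset.
  move: ltK (iI _ sDI); rewrite (cardsD1 x K) xK -{1}(setD1K xK) suppU1 => ltK leK.
  have eqS : supp S (K :\ x) = S x :|: supp S (K :\ x).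
    by apply/eqP; rewrite eqEcard subsetUr; lia.
  have sST : supp S (K :\ x) \subset supp S T.
    by apply/suppS/(bigcup_sup (K :\ x)); rewrite /tight sDI eqS; lia.
  by apply: subset_trans sST; rewrite eqS subsetUl.
(* This bounds [J :\: I] by [T :\: J], which lies in the smaller set [I :\: J]. *)
have : #|(J :&: T) :|: (J :\: I)| <= #|T|.
  apply: leq_trans tT; apply: leq_trans (iJ _ _) _.
    by rewrite subUset subsetIl subsetDl.
  apply: subset_leq_card; rewrite suppU subUset suppS ?subsetIr //=.
  exact/bigcupsP.
rewrite cardsU (_ : _ :&: (J :\: I) = set0) ?cards0; last first.
  apply/setP=> x; rewrite !inE; case: (boolP (x \in T)) => xT; rewrite ?andbF //.
  by rewrite (subsetP sTI) ?andbF.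
have := subset_leq_card (setSD J sTI); have := cardsID I J; have := cardsID J I.
have := cardsID J T; rewrite ![_ :&: J]setIC; lia.
Qed.

Definition hall_matroid := Matroid hall_indep0 hall_indepS hall_indep_aug.

Lemma hall_matching (r : V -> E) (W : {set V}) : injective r ->
  (forall v, v \in S (r v)) -> r @: W \in indep hall_matroid.
Proof.
move=> injr rS; apply/hall_indepP => _ /subset_imset[K _ ->].
rewrite card_imset //; apply: subset_leq_card; apply/subsetP=> v vK.
by apply: (subsetP (mem_supp S (imset_f r vK))).
Qed.

Lemma hall_rank_support X : rank hall_matroid X <= #|supp S X|.
Proof.
apply/rank_leP => I sIX /hall_indepP iI.
by apply: leq_trans (iI I _) _; rewrite ?subset_leq_card ?suppS.
Qed.

(** Adding [e] to a largest independent subset of [X] keeps Hall's condition, since [e] brings a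
    vertex outside the support of [X]. *)
Lemma hall_rank_new e X :
  ~~ (S e \subset supp S X) -> rank hall_matroid X < rank hall_matroid (e |: X).
Proof.
move=> SeX; have eX : e \notin X by apply: contra SeX => /mem_supp.
have [I [sIX /hall_indepP iI <-]] := rank_witness hall_matroid X.
have eI : e \notin I by apply: contra eX; apply: subsetP.
have cI : #|e |: I| = #|I|.+1 by rewrite cardsU1 eI.
rewrite -cI; apply: indep_rank; last exact: setUS.
apply/hall_indepP => J sJ; have [eJ|eJ] := boolP (e \in J); last first.
  apply: iI; apply/subsetP=> y yJ; have /setU1P[ey|//] := subsetP sJ y yJ.
  by rewrite -ey yJ in eJ.
have sDI : J :\ e \subset I by rewrite subDset.
rewrite (cardsD1 e J) eJ -{2}(setD1K eJ) suppU1 add1n.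
apply: leq_ltn_trans (iI _ sDI) _; apply: proper_card; apply/properP.
split; first exact: subsetUr.
have /subsetPn[v vSe vX] := SeX; exists v; first by rewrite inE vSe.
by apply: contra vX; apply: subsetP; apply: suppS; apply: subset_trans sIX.
Qed.

End HallMatroid.

(** Add for each vertex [v] an element [inl v] with support [[set v]]. These elements form the basis
    of joints, and [inl @: S e] spans [e]. *)
Lemma hall_frame_matroid (E V : finType) (S : E -> {set V}) :
  (forall e, #|S e| <= 2) -> frame_matroid (hall_matroid S).
Proof.
move=> S2; pose S' (y : V + E) := match y with inl v => [set v] | inr e => S e end.
have inlS (J : {set V}) : supp S' (inl @: J) = J.
  rewrite supp_imset; apply/setP=> v; apply/bigcupP/idP => [[w wJ /set1P->//]|vJ].
  by exists v; rewrite // set11.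
have indV (J : {set V}) : inl @: J \in indep (hall_matroid S').
  apply/hall_indepP => _ /subset_imset[K _ ->].
  by rewrite inlS card_imset //; apply: inl_inj.
exists (V + E)%type, (hall_matroid S'), inr; split.
  exists (inl @: [set: V]).
    apply/maxsetP; split=> [|B iB sB]; first exact: indV.
    apply/esym/eqP; rewrite eqEcard sB.
    rewrite -(rank_indep iB) (leq_trans (hall_rank_support _ _)) //.
    by rewrite card_imset ?subset_leq_card //; apply: inl_inj.
  move=> e; exists (inl @: S' e); split; first exact/imsetS/subsetT.
    by rewrite card_imset; [case: e => [v|e] /=; rewrite ?cards1 | apply: inl_inj].
  rewrite inE rank_absorbE (rank_indep (indV _)) (leq_trans (hall_rank_support _ _)) //.
  by rewrite suppU1 inlS setUid card_imset //; apply: inl_inj.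
have injr : injective (@inr V E) by apply: inr_inj.
split=> // A; apply/hall_indepP/hall_indepP => [iA _ /subset_imset[J sJA ->]|iA J sJA].
  by rewrite supp_imset card_imset //; apply: iA.
by have := iA _ (imsetS inr sJA); rewrite supp_imset card_imset.
Qed.

(* Each element is a loop at a vertex of its own: in this definition of a
   framework such a totally disconnected graph meets all conditions. *)
Lemma quasi_graphic_any (E : finType) (M : matroid E) : quasi_graphic M.
Proof.
have loop1 (e : E) : 0 < #|[set e]| <= 2 by rewrite cards1.
exists (Graph loop1); split=> v.
  apply: leq_trans (rank_card _ _) _; apply: subset_leq_card; apply/subsetP=> e.
  by rewrite !inE sub1set inE.
apply/subsetP=> e _; rewrite !inE eq_sym; case: (eqVneq v e) => //= ->.
by rewrite eqxx.
Qed.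

(** * Declaring a free basis dependent, the reverse of relaxing a circuit-hyperplane *)

Section Tightening.
Variables (E : finType) (M : matroid E) (B : {set E}).
Hypothesis B_gt0 : 0 < #|B|.
Hypothesis maxB : forall I, I \in indep M -> #|I| <= #|B|.
Hypothesis freeB : forall e f, e \notin B -> f \in B -> e |: (B :\ f) \in indep M.

Definition tight_indep : {pred {set E}} := [pred I | (I \in indep M) && (I != B)].

Lemma tight_indep0 : set0 \in tight_indep.
Proof. by rewrite inE indep0 eq_sym -card_gt0. Qed.

Lemma tight_indepS (I J : {set E}) :
  J \subset I -> I \in tight_indep -> J \in tight_indep.
Proof.
move=> sJI; rewrite !inE => /andP[iI nIB]; rewrite (indepS sJI iI) /=.
apply: contra nIB => /eqP eJ; rewrite eq_sym eqEcard -{1}eJ sJI; exact: maxB.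
Qed.

(** If augmenting [I] by [x] gives exactly [B], then [J] is at least as large as [B] but different
    from it, so it has an element outside [B] that can replace [x]. *)
Lemma tight_indep_aug (I J : {set E}) : I \in tight_indep -> J \in tight_indep ->
  #|I| < #|J| -> exists2 x, x \in J :\: I & x |: I \in tight_indep.
Proof.
rewrite !inE => /andP[iI nI] /andP[iJ nJ] ltIJ.
have [x xJI iIx] := indep_aug iI iJ ltIJ.
have [eB|] := eqVneq (x |: I) B; last by move=> nB; exists x; rewrite // inE iIx.
have /setDP[xJ xI] := xJI.
have leBJ : #|B| <= #|J| by rewrite -eB cardsU1 xI.
have /subsetPn[e eJ eNB] : ~~ (J \subset B) by apply: contra nJ; rewrite eqEcard leBJ andbT.
have eI : e \notin I by apply: contra eNB; rewrite -eB; apply: setU1r.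
exists e; rewrite inE ?eI ?eJ //.
have -> : e |: I = e |: (B :\ x) by rewrite -eB setU1K.
have xB : x \in B by rewrite -eB setU11.
by rewrite freeB //=; apply: contra eNB => /eqP <-; apply: setU11.
Qed.

Definition tighten := Matroid tight_indep0 tight_indepS tight_indep_aug.

Lemma rank_tighten X : X != B -> rank tighten X = rank M X.
Proof.
move=> nX; apply/eqP; rewrite eqn_leq; apply/andP; split; apply/rank_leP => I sIX.
  by case/andP=> iI _; apply: indep_rank.
move=> iI; have [eI|nI] := eqVneq I B; last by apply: indep_rank; rewrite // inE iI.
(* Only [B] itself is lost as an independent subset of [X]; an exchange with an element of [X]
   outside [B] gives another of the same size. *)
rewrite eI in sIX *; have [f fB] := card_gt0P B_gt0.
have /subsetPn[e eX eB] : ~~ (X \subset B) by apply: contra nX; rewrite eqEsubset sIX andbT.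
have cB : #|e |: (B :\ f)| = #|B|.
  by rewrite cardsU1 !inE (negPf eB) andbF /= (cardsD1 f B) fB.
rewrite -cB; apply: indep_rank.
  by rewrite inE freeB //=; apply: contra eB => /eqP <-; apply: setU11.
by rewrite subUset sub1set eX (subset_trans (subsetDl _ _)).
Qed.

Lemma rank_tighten_lt : rank tighten B < #|B|.
Proof.
rewrite ltnNge; apply/negP; have [I [sIB /andP[_ nI] <-]] := rank_witness tighten B.
by move=> leI; rewrite eqEcard sIB leI in nI.
Qed.

End Tightening.

(** * Induction around a cycle, and counting *)

Lemma ordS_ind n (P : pred 'I_n) (j : 'I_n) :
  P j -> (forall i, P i -> P (ordS i)) -> forall i, P i.
Proof.
move=> Pj PS i; have n_gt0 : 0 < n by apply: leq_ltn_trans (ltn_ord i).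
have Pk k : P (Ordinal (ltn_pmod (j + k) n_gt0)).
  elim: k => [|k /PS]; first by congr P: Pj; apply: val_inj; rewrite /= addn0 modn_small.
  by congr P; apply: val_inj; rewrite /= addnS -addn1 modnDml addn1.
(* Going [n - j] steps from [j] reaches 0, and [i] more reach [i]. *)
congr P: (Pk (n - j + i)); apply: val_inj => /=.
by rewrite addnA subnKC ?(ltnW (ltn_ord j)) // modnDl modn_small.
Qed.

Lemma ordS_neq n (i : 'I_n) : 1 < n -> ordS i != i.
Proof.
move=> n1; rewrite -val_eqE /=; have := ltn_ord i; rewrite leq_eqVlt => /orP[/eqP ei|lt].
  by rewrite ei modnn; lia.
by rewrite modn_small //; lia.
Qed.

Lemma card_bigcup_leq (I T : finType) (P : pred I) (F : I -> {set T}) (k : nat) :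
  (forall i, P i -> #|F i| <= k) -> #|\bigcup_(i | P i) F i| <= #|P| * k.
Proof.
move=> Fk; rewrite -sum_nat_const.
apply: (big_rec2 (fun (A : {set T}) m => #|A| <= m)); first by rewrite cards0.
move=> i m A Pi leA; apply: leq_trans (leq_card_setU _ _) _.
by rewrite leq_add ?Fk.
Qed.

(* Each point of the union lies in all but at most one of the four sets. *)
Lemma four_pairs (V : finType) (S : 'I_4 -> {set V}) : (forall k, #|S k| <= 2) ->
  (forall k l m, k != l -> S m \subset S k :|: S l) -> #|\bigcup_k S k| <= 2.
Proof.
move=> S2 Skl; set U := \bigcup_k S k.
have ge3 v : v \in U -> 3 <= \sum_k (v \in S k).
  case/bigcupP=> m _ vm; pose A := [set k | v \in S k].
  have -> : \sum_k (v \in S k) = #|A|.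
    by rewrite -sum1_card [RHS]big_mkcond; apply: eq_bigr => k _; rewrite inE; case: ifP.
  have : #|~: A| <= 1.
    apply/card_le1_eqP => k l /[!inE] vk vl; apply/eqP/contraT => nkl.
    by have := subsetP (Skl _ _ m nkl) v vm; rewrite inE (negPf vk) (negPf vl).
  by have := cardsC A; rewrite card_ord; lia.
have : \sum_(v in U) 3 <= \sum_(k < 4) 2.
  apply: (@leq_trans (\sum_(v in U) \sum_k (v \in S k))); first exact: leq_sum.
  rewrite exchange_big; apply: leq_sum => k _.
  apply: leq_trans _ (S2 k); rewrite -sum1_card big_mkcond [X in _ <= X]big_mkcond.
  by apply: leq_sum => v _; case: ifP; case: ifP.
by rewrite !sum_nat_const card_ord; lia.
Qed.

(** * The prism and its bicircular matroid *)

Section Prism.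
Variable n : nat.
Hypothesis n_gt1 : 1 < n.

(* Vertices are pairs (i, s); the edges are four parallel rungs inl (i, _)
   between (i, false) and (i, true), and crosses inr (i, (s, t)) between (i, s)
   and (i + 1, t), with i + 1 taken modulo n. *)
Definition prism_edge : finType := ('I_n * 'I_4 + 'I_n * (bool * bool))%type.

Definition prism_ends (e : prism_edge) : {set 'I_n * bool} :=
  match e with
  | inl (i, _) => [set (i, false); (i, true)]
  | inr (i, (s, t)) => [set (i, s); (ordS i, t)]
  end.

Definition prism_matroid := hall_matroid prism_ends.

Lemma card_prism_edge : #|{: prism_edge}| = 8 * n.
Proof. by rewrite card_sum !card_prod !card_ord !card_bool -mulnDr mulnC. Qed.

Lemma card_prism_ends e : #|prism_ends e| <= 2.
Proof. by case: e => [[i k]|[i [s t]]]; rewrite cards2; case: eqP. Qed.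

Definition rungs (P : {set 'I_n}) : {set prism_edge} :=
  [set e | if e is inl (i, _) then i \in P else false].

Lemma supp_rungs P : supp prism_ends (rungs P) = [set v | v.1 \in P].
Proof.
apply/setP=> [[i b]]; rewrite inE /=; apply/bigcupP/idP => [[[[j k]|[j c]]]|iP].
- by rewrite inE => jP /set2P[] [->].
- by rewrite inE.
by exists (inl (i, ord0)); rewrite /= !inE //; case: b {iP}; rewrite eqxx ?orbT.
Qed.

Lemma card_over (P : {set 'I_n}) : #|[set v : 'I_n * bool | v.1 \in P]| = #|P| * 2.
Proof.
have -> : [set v : 'I_n * bool | v.1 \in P] = setX P setT.
  by apply/setP=> v; rewrite !inE andbT.
by rewrite cardsX cardsT card_bool.
Qed.

Lemma card_verts : #|{: 'I_n * bool}| = n * 2.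
Proof. by rewrite card_prod card_ord card_bool. Qed.

(** For [k != l] this matches the vertices with distinct rungs of their own fibres. *)
Definition rung_at (k l : 'I_4) (v : 'I_n * bool) : prism_edge :=
  inl (v.1, if v.2 then k else l).

Lemma rung_at_inj k l : k != l -> injective (rung_at k l).
Proof.
move=> nkl [i b] [j c]; rewrite /rung_at /= => -[-> /eqP]; case: b; case: c => //.
  by rewrite (negPf nkl).
by rewrite eq_sym (negPf nkl).
Qed.

Lemma rungs_indep k l (W : {set 'I_n * bool}) :
  k != l -> rung_at k l @: W \in indep prism_matroid.
Proof.
move=> /rung_at_inj inj; apply: (hall_matching _ inj) => -[i b].
by rewrite /= !inE; case: b; rewrite eqxx ?orbT.
Qed.

Lemma rank_rungs (P : {set 'I_n}) : #|P| * 2 <= rank prism_matroid (rungs P).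
Proof.
have ne : ord0 != ord_max :> 'I_4 by [].
rewrite -card_over -(card_imset _ (rung_at_inj ne)) indep_rank ?rungs_indep //.
by apply/subsetP=> _ /imsetP[v vP ->]; rewrite !inE in vP *.
Qed.

(** * The pair of cycles given by a transversal *)

Section Transversal.
Variable x : 'I_n -> bool.

(* The crosses of cyc x @: setT join (i, c + x i) to (i + 1, c + x (i + 1)),
   forming one cycle for each c. *)
Definition cyc (v : 'I_n * bool) : prism_edge :=
  inr (v.1, (v.2, v.2 (+) x v.1 (+) x (ordS v.1))).

Lemma cyc_inj : injective cyc.
Proof. by move=> [i b] [j c] [-> ->]. Qed.

Definition cycles : {set prism_edge} := cyc @: setT.

Lemma cyc_indep (W : {set 'I_n * bool}) : cyc @: W \in indep prism_matroid.
Proof. by apply: (hall_matching _ cyc_inj) => -[i b]; rewrite !inE eqxx. Qed.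

Lemma card_cycles : #|cycles| = n * 2.
Proof. by rewrite card_imset ?cardsT ?card_verts //; apply: cyc_inj. Qed.

Lemma cycles_max (I : {set prism_edge}) : I \in indep prism_matroid -> #|I| <= #|cycles|.
Proof.
move=> iI; rewrite -(rank_indep iI) card_cycles -card_verts.
by rewrite (leq_trans (hall_rank_support _ _)) ?max_card.
Qed.

Lemma cyclesE i s t : (inr (i, (s, t)) \in cycles) = (t == s (+) x i (+) x (ordS i)).
Proof.
apply/imsetP/eqP => [[[j b] _ [-> -> ->]]//|->].
by exists (i, s).
Qed.

Lemma cycles_rung ik : inl ik \notin cycles.
Proof. by apply/imsetP => -[]. Qed.

(* e has an endvertex u on the same cycle as f; were e + (B - f) dependent, the
   starting points of the crosses it contains would be closed under following
   that cycle, and so f would be among these crosses. *)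
Lemma cycles_free e f : e \notin cycles -> f \in cycles ->
  e |: (cycles :\ f) \in indep prism_matroid.
Proof.
(* [side v] tells which of the two cycles passes through [v]. *)
move=> eB /imsetP[w _ ->]; pose side (v : 'I_n * bool) := v.2 (+) x v.1.
have [u ue uw] : exists2 u, u \in prism_ends e & side u = side w.
  rewrite /side; case: e eB => [[i k]|[i [s t]]] /=.
    exists (i, side w (+) x i); last by rewrite /= addbK.
    by rewrite !inE; case: (side w (+) x i); rewrite eqxx ?orbT.
  rewrite cyclesE => neq; have [es|ns] := eqVneq (s (+) x i) (w.2 (+) x w.1).
    by exists (i, s); rewrite ?inE ?eqxx.
  exists (ordS i, t); rewrite ?inE ?eqxx ?orbT //=.
  by move: neq ns; case: (w.2 (+) x w.1); case: s; case: t; case: (x i); case: (x _).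
apply/hall_indepP => J sJ; have [eJ|eJ] := boolP (e \in J); last first.
  have /hall_indepP := cyc_indep setT; apply; apply/subsetP=> y yJ.
  have /setU1P[ey|/setD1P[]//] := subsetP sJ y yJ; by rewrite -ey yJ in eJ.
have sDJ : J :\ e \subset cycles :\ cyc w by rewrite subDset.
have /subset_imset[K _ eK] := subset_trans sDJ (subsetDl _ _).
have sKJ : K \subset supp prism_ends J.
  apply/subsetP=> v vK; have: cyc v \in J :\ e by rewrite eK imset_f.
  case/setD1P=> _ /(mem_supp prism_ends)/subsetP; apply.
  by rewrite /= !inE -surjective_pairing eqxx.
rewrite (cardsD1 e) eJ eK card_imset; last exact: cyc_inj.
rewrite add1n ltnNge; apply/negP => leK.
have eKJ : supp prism_ends J = K by apply/esym/eqP; rewrite eqEcard sKJ.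
have on_cycle : forall i, (i, side u (+) x i) \in K.
  apply: (@ordS_ind _ _ u.1) => [|i iK].
    rewrite /side addbK -surjective_pairing -eKJ.
    exact: (subsetP (mem_supp _ eJ)).
  have: cyc (i, side u (+) x i) \in J :\ e by rewrite eK imset_f.
  case/setD1P=> _ /(mem_supp prism_ends)/subsetP; rewrite eKJ; apply.
  by rewrite /= !inE addbK eqxx orbT.
have := on_cycle w.1; rewrite uw /side addbK -surjective_pairing => wK.
have : cyc w \in J :\ e by rewrite eK imset_f.
by move/(subsetP sDJ); rewrite !inE eqxx.
Qed.

Lemma cycles_gt0 : 0 < #|cycles|.
Proof. by rewrite card_cycles; lia. Qed.

Definition prism_tightened := tighten cycles_gt0 cycles_max cycles_free.

(** * The tightened matroid has no frame support *)

Section NotFrame.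
Variables (V : finType) (S : prism_edge -> {set V}).
Hypothesis frameS : frame_support prism_tightened S.

Let r := rank prism_matroid.

Let S2 e : #|S e| <= 2. Proof. by case: frameS. Qed.

Let r_le (X : {set prism_edge}) : X != cycles -> r X <= #|supp S X|.
Proof.
have [_ Sr _ _] := frameS => nX.
by rewrite /r -(rank_tighten cycles_gt0 cycles_max cycles_free nX) Sr.
Qed.

Let absorbS e (X : {set prism_edge}) : e |: X != cycles -> X != cycles ->
  r (e |: X) <= r X -> S e \subset supp S X.
Proof.
move=> neX nX le; have [_ _ Sa _] := frameS; apply: Sa.
by apply/eqP; rewrite rank_absorbE !rank_tighten.
Qed.

Let r_ends (X : {set prism_edge}) : r X <= #|supp prism_ends X|.
Proof. exact: hall_rank_support. Qed.

(** Lets ranks in the prism matroid be used for every set with a rung, as the two rank functions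
    agree there. *)
Let neq_rung i k (X : {set prism_edge}) : inl (i, k) \in X -> X != cycles.
Proof. by move=> iX; apply: contraTneq iX => ->; apply: cycles_rung. Qed.

Let fiber i := supp S (rungs [set i]).

Let supp_rungs1 i : fiber i = \bigcup_k S (inl (i, k)).
Proof.
apply/eqP; rewrite /fiber eqEsubset; apply/andP; split; apply/bigcupsP.
  by case=> [[j k]|[j c]]; rewrite !inE // => /eqP->; apply: (bigcup_sup k).
by move=> k _; apply: (mem_supp S); rewrite !inE.
Qed.

(** Any two rungs of a fibre span the other two, so the joints of all four lie in the union of any
    two supports. *)
Let card_rungs1 i : #|fiber i| <= 2.
Proof.
rewrite supp_rungs1; apply: four_pairs => // k l m nkl.
rewrite -(supp1 S (inl (i, l))) -suppU1.
apply: absorbS; rewrite ?(@neq_rung i k) ?inE ?eqxx ?orbT //.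
have -> : [set inl (i, k); inl (i, l)] = rung_at k l @: [set v | v.1 \in [set i]].
  apply/setP=> e; apply/set2P/imsetP => [[]->|[[j b]]].
  - by exists (i, true); rewrite ?inE.
  - by exists (i, false); rewrite ?inE.
  by rewrite !inE => /eqP/= -> ->; case: b; [left|right].
rewrite /r [leqRHS]rank_indep ?rungs_indep // card_imset; last exact: rung_at_inj.
apply: leq_trans (r_ends _) _; rewrite -[in leqRHS]supp_rungs.
apply/subset_leq_card/suppS; apply/subsetP=> e /setU1P[->|/imsetP[v + ->]]; first by rewrite !inE.
by rewrite !inE /= => /eqP->; apply: set11.
Qed.

Let card_rungsS (P : {set 'I_n}) : #|supp S (rungs P)| <= #|P| * 2.
Proof.
have -> : supp S (rungs P) = \bigcup_(i in P) fiber i.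
  apply/eqP; rewrite eqEsubset; apply/andP; split; apply/bigcupsP.
    case=> [[j k]|[j c]]; rewrite !inE // => jP; apply: (bigcup_max j) => //.
    by apply: (mem_supp S); rewrite !inE.
  move=> i iP; apply: suppS; apply/subsetP=> -[[j k]|[j c]]; rewrite !inE //.
  by move/eqP->.
exact: card_bigcup_leq.
Qed.

Let all := supp S (rungs setT).
Let butrungs i := rungs [set~ i].
Let but i := supp S (butrungs i).

Let card_all : #|all| = n * 2.
Proof.
apply/eqP; rewrite eqn_leq; have:= card_rungsS setT; rewrite cardsT card_ord => -> /=.
have := rank_rungs setT; rewrite cardsT card_ord => /leq_trans; apply; apply: r_le.
by apply: (@neq_rung (Ordinal (ltnW n_gt1)) ord0); rewrite !inE.
Qed.

Let card_but i : #|but i| <= n.-1 * 2.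
Proof. by apply: leq_trans (card_rungsS _) _; rewrite cardsC1 card_ord. Qed.

(** The rungs already have full rank [n * 2], hence span every edge. *)
Let sub_all (X : {set prism_edge}) : supp S X \subset all.
Proof.
apply/bigcupsP => e _; have i0 := Ordinal (ltnW n_gt1).
apply: absorbS; rewrite ?(@neq_rung i0 ord0) ?inE ?orbT //.
rewrite (leq_trans (r_ends _)) // (leq_trans (max_card _)) // card_verts.
by have := rank_rungs setT; rewrite cardsT card_ord.
Qed.

Let but_neq i (X : {set prism_edge}) : butrungs i \subset X -> X != cycles.
Proof.
by move/subsetP=> sX; apply: (@neq_rung (ordS i) ord0); apply: sX; rewrite !inE ordS_neq.
Qed.

Let rank_but i : n.-1 * 2 <= r (butrungs i).
Proof. by have := rank_rungs [set~ i]; rewrite cardsC1 card_ord. Qed.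

Let all_but i j : i != j -> all = but i :|: but j.
Proof.
move=> nij; rewrite /but -suppU; congr supp; apply/setP=> -[[k l]|[k l]]; rewrite !inE //.
by rewrite -negb_and; case: eqP => // ->.
Qed.

(** The joints of [e] that belong to fibre [i], obtained by removing those of the other fibres. *)
Let out i e : {set V} := S e :\: but i.

(** Otherwise [e] and the rungs outside fibre [i] would have rank above [n.-1 * 2] on at most that
    many joints. *)
Let out_gt0 i s e : (i, s) \in prism_ends e -> 0 < #|out i e|.
Proof.
move=> ie; rewrite card_gt0 setD_eq0; apply/negP => sSe.
have: r (butrungs i) < r (e |: butrungs i).
  apply: hall_rank_new; apply/subsetPn; exists (i, s) => //.
  by rewrite supp_rungs !inE /= eqxx.
have := r_le (but_neq (subsetUr [set e] (butrungs i))).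
rewrite suppU1 (setUidPr sSe); have := card_but i; have := rank_but i; rewrite /but; lia.
Qed.

Let out_disj i j e : i != j -> [disjoint out i e & out j e].
Proof.
move=> nij; rewrite -setI_eq0; apply/eqP/setP=> v; rewrite !inE.
have [ve|] := boolP (v \in S e); last by rewrite !andbF.
have := subsetP (sub_all [set e]) v; rewrite supp1 => /(_ ve).
by rewrite (all_but nij) !inE !andbT -negb_or => ->.
Qed.

(** A cross has at most two joints and needs one in each of the two fibres it meets. *)
Let outP i s t : let e := inr (i, (s, t)) in
  [/\ #|out i e| = 1, #|out (ordS i) e| = 1 & S e = out i e :|: out (ordS i) e].
Proof.
move=> e; have ni : i != ordS i by rewrite eq_sym ordS_neq.
have g1 : 0 < #|out i e| by apply: (@out_gt0 i s); rewrite !inE eqxx.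
have g2 : 0 < #|out (ordS i) e| by apply: (@out_gt0 _ t); rewrite !inE eqxx orbT.
have sU : out i e :|: out (ordS i) e \subset S e by rewrite subUset !subsetDl.
have cU : #|out i e :|: out (ordS i) e| = #|out i e| + #|out (ordS i) e|.
  by apply/eqP; rewrite (leq_card_setU _ _) out_disj.
have := subset_leq_card sU; have := S2 e; split; try lia.
by apply/esym/eqP; rewrite eqEcard sU; lia.
Qed.

(** Both crosses and the rungs outside fibre [ordS i] miss the vertex [(ordS i, ~~ t)], so their
    rank is below [n * 2]. The second cross with these rungs attains that rank and thus spans the
    first, which forces a common joint in fibre [ordS i]. *)
Let meet i s t u : S (inr (i, (s, t))) \subset
  but (ordS i) :|: S (inr (ordS i, (t, u))).
Proof.
set e := inr (i, _); set e' := inr (ordS i, _).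
rewrite setUC -suppU1; apply: absorbS; rewrite ?(@but_neq (ordS i)) ?subsetUr //.
  by rewrite setUA subsetUr.
apply: (@leq_trans (n.-1 * 2).+1); last first.
  apply: leq_ltn_trans (rank_but (ordS i)) _; apply: hall_rank_new.
  apply/subsetPn; exists (ordS i, t); first by rewrite !inE eqxx.
  by rewrite supp_rungs !inE /= eqxx.
apply: leq_trans (r_ends _) _.
have: supp prism_ends (e |: (e' |: butrungs (ordS i))) \subset [set~ (ordS i, ~~ t)].
  have ni := ordS_neq i n_gt1; have ni' := ordS_neq (ordS i) n_gt1.
  rewrite !suppU1 supp_rungs !subUset !sub1set !inE !xpair_eqE.
  rewrite eq_sym (negPf ni) (negPf ni') eqxx /=; case: (t) => /=.
    by apply/subsetP=> v; rewrite !inE; apply: contra => /eqP->.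
  by apply/subsetP=> v; rewrite !inE; apply: contra => /eqP->.
move/subset_leq_card/leq_trans; apply; rewrite cardsC1 card_verts; lia.
Qed.

Definition half c : {set prism_edge} := [set cyc (i, c (+) x i) | i : 'I_n].

(** By [meet], the joint of a cross in the next fibre is the one from which the following cross
    leaves, so [n] joints carry the [n] independent crosses. *)
Let half_sat c : #|supp S (half c)| <= rank prism_tightened (half c).
Proof.
have ch : #|half c| = n.
  by rewrite card_imset ?cardsT ?card_ord // => i j /cyc_inj[].
have sh : half c \subset cycles.
  by apply/subsetP=> _ /imsetP[i _ ->]; apply: imset_f.
have nh : half c != cycles.
  by apply: contraTneq n_gt1 => eh; have := card_cycles; rewrite -eh ch; lia.
have ih : half c \in indep prism_matroid by apply: indepS sh (cyc_indep _).
rewrite rank_tighten // (rank_indep ih) ch.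
have: supp S (half c) \subset \bigcup_i out i (cyc (i, c (+) x i)).
  apply/bigcupsP=> _ /imsetP[i _ ->]; set e := cyc _.
  have [_ _ eS] := @outP i (c (+) x i) (c (+) x i (+) x i (+) x (ordS i)).
  rewrite [S e]eS subUset (bigcup_sup i) //= (subset_trans _ (bigcup_sup (ordS i) _)) //.
  apply: subset_trans (setSD _ (meet _ _ _ (c (+) x (ordS (ordS i))))) _.
  by rewrite setDUl setDv set0U /cyc /= !addbK.
move/subset_leq_card/leq_trans; apply.
rewrite -[leqRHS]muln1 -[n in leqRHS]card_ord; apply: card_bigcup_leq => i _.
by have [-> _ _] := @outP i (c (+) x i) (c (+) x i (+) x i (+) x (ordS i)).
Qed.

Let cycles_half : cycles = half false :|: half true.
Proof.
apply/setP=> e; apply/imsetP/setUP => [[[i b] _ ->]|[]/imsetP[i _ ->]].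
- by case eb: (b (+) x i); [right|left]; apply/imsetP; exists i; rewrite // -eb addbK.
- by exists (i, false (+) x i).
by exists (i, true (+) x i).
Qed.

(** The two crosses leaving fibre [i] and the rungs of the other fibres have rank [n * 2], so their
    supports cover [all]. The joints of fibre [i] avoid those of the other fibres, hence come from
    the two crosses. *)
Let all_cycles : all \subset supp S cycles.
Proof.
apply/bigcupsP=> -[[i k]|[i c]]; rewrite inE // => _.
pose e := cyc (i, false); pose e' := cyc (i, true).
have sU : S e :|: S e' :|: but i \subset all.
  by rewrite !subUset -(supp1 S e) -(supp1 S e') !sub_all.
have: n * 2 <= #|S e :|: S e' :|: but i|.
  have: r (butrungs i) < r (e' |: butrungs i).
    apply: hall_rank_new; apply/subsetPn; exists (i, true); first by rewrite !inE eqxx.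
    by rewrite supp_rungs !inE /= eqxx.
  have: r (e' |: butrungs i) < r (e |: (e' |: butrungs i)).
    apply: hall_rank_new; apply/subsetPn; exists (i, false); first by rewrite !inE eqxx.
    rewrite suppU1 supp_rungs /= !inE !xpair_eqE eqxx /= ?andbF ?andbT /=.
    by rewrite eq_sym (negPf (ordS_neq i n_gt1)).
  have := r_le (@but_neq i (e |: (e' |: butrungs i)) _).
  rewrite !suppU1 !setUA subsetUr => /(_ isT).
  have := rank_but i; rewrite -/(but i); lia.
rewrite -card_all => leU; have eU : S e :|: S e' :|: but i = all.
  by apply/eqP; rewrite eqEcard sU.
have dR : fiber i :&: but i = set0.
  have eA : all = fiber i :|: but i.
    rewrite /but /fiber -suppU; congr supp; apply/setP=> -[[j l]|[j l]]; rewrite !inE //.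
    by rewrite orbN.
  have := cardsUI (fiber i) (but i); rewrite -eA card_all.
  by have := card_rungs1 i; have := card_but i => *; apply: cards0_eq; lia.
apply/subsetP=> v ve; have vR : v \in fiber i.
  by rewrite supp_rungs1; apply/bigcupP; exists k.
have : v \in all by apply: (subsetP (mem_supp S _)) ve; rewrite inE.
rewrite -eU => /setUP[|vb]; last by move/setP: dR => /(_ v); rewrite inE vR vb inE.
case/setUP; apply: subsetP; apply: mem_supp; exact: imset_f.
Qed.

Lemma frame_support_absurd : False.
Proof.
have [_ _ _ /(_ _ _ (half_sat false) (half_sat true))] := frameS.
rewrite -cycles_half leqNgt (leq_trans (rank_tighten_lt _ _ _)) //.
by rewrite card_cycles -card_all subset_leq_card.
Qed.

End NotFrame.

Lemma prism_tightened_not_frame : ~ frame_matroid prism_tightened.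
Proof. by move/frame_matroid_support => [V [S]]; apply: frame_support_absurd. Qed.

End Transversal.

(** The crosses from fibre [i] record only [x i (+) x (ordS i)], so complementary choices give the
    same set and one value must be fixed. *)
Lemma cycles_determine (x y : 'I_n -> bool) i0 :
  x i0 = y i0 -> cycles x = cycles y -> x =1 y.
Proof.
move=> x0 eqC i; apply/eqP.
apply: (@ordS_ind _ (fun i => x i == y i) i0) i => [|i /eqP xi]; first exact/eqP.
have: inr (i, (x i, x (ordS i))) \in cycles x by rewrite cyclesE addbb.
by rewrite eqC cyclesE xi addbb => /eqP->.
Qed.

End Prism.

(** * Exponential against polynomial growth *)

Section Growth.
Local Open Scope ring_scope.

Lemma horner_nat_bound (R : archiRealDomainType) (p : {poly R}) :
  exists c d : nat, forall m : nat, (0 < m)%N -> p.[m%:R] <= (c * m ^ d)%:R.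
Proof.
exists (\sum_(i < size p) Num.bound (`|p`_i|)%R)%N, (size p) => m m_gt0.
rewrite horner_coef natrM natr_sum mulr_suml; apply: ler_sum => i _.
have m1 : 1 <= m%:R :> R by rewrite ler1n.
apply: le_trans (ler_norm _) _; rewrite normrM.
apply: ler_pM => //; first by rewrite ltW // archi_boundP.
rewrite ger0_norm ?exprn_ge0 ?ler0n // natrX; apply: ler_weXn2l => //.
exact: ltnW.
Qed.

End Growth.

Lemma exp_dominates (c d : nat) : exists2 n, 1 < n & c * n ^ d < 2 ^ n.
Proof.
(* With this [n], [c * n ^ d] is below [2 ^ (c + 2 * t * d)], and [t] is chosen so that this
   exponent is at most [t * t <= n]. *)
pose t := (2 * d + c).+1; exists (2 ^ (2 * t)).
  by rewrite -{1}(expn0 2) ltn_exp2l // muln_gt0.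
apply: (@leq_trans (2 ^ (c + 2 * t * d))).
  by rewrite expnD -expnM ltn_pmul2r ?expn_gt0 // ltn_expl.
rewrite leq_exp2l // [in leqRHS]mul2n -addnn expnD.
have lt_t : t <= 2 ^ t by apply/ltnW/ltn_expl.
by apply: leq_trans (leq_mul lt_t lt_t); rewrite /t; nia.
Qed.

(** * Choice of a basis outside the given family *)

Local Open Scope ring_scope.

Theorem theorem3p1 (R : archiRealDomainType) (p : {poly R}) :
  exists (E : finType) (M : matroid E),
    frame_matroid M /\
    forall A : {set {set E}},
      (#|A|%:R : R) <= p.[#|E|%:R] ->
      exists M' : matroid E,
        [/\ quasi_graphic M', ~ frame_matroid M'
          & forall X : {set E}, X \in A -> rank M' X = rank M X].
Proof.
have [c [d pc]] := horner_nat_bound p.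
(* The ground set has [8 * n] elements, and the factor 2 pays for the two choices of [x] with the
   same cycles. *)
have [n n_gt1 lt_n] := exp_dominates (2 * (c * 8 ^ d)) d.
exists (prism_edge n), (prism_matroid n); split=> [|A leA].
  exact/hall_frame_matroid/card_prism_ends.
have ltA : (2 * #|A| < 2 ^ n)%N.
  apply: leq_ltn_trans lt_n; rewrite -!mulnA leq_mul2l /= -expnMn -card_prism_edge.
  rewrite -(ler_nat R); apply: le_trans leA (pc _ _).
  by rewrite card_prism_edge; lia.
pose i0 := Ordinal (ltnW n_gt1).
have [x xA] : exists x : {ffun 'I_n -> bool}, cycles x \notin A.
  apply/existsP; apply: contraLR ltA; rewrite negb_exists -leqNgt => /forallP inA.
  (* Were all the bases in [A], this injection into pairs of a boolean and a member of [A] would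
     give [2 ^ n <= 2 * #|A|]. *)
  pose f (x : {ffun 'I_n -> bool}) := (x i0, cycles x).
  have injf : injective f.
    by move=> x y [e0 eC]; apply/ffunP; apply: cycles_determine e0 eC.
  have <- : #|[set: {ffun 'I_n -> bool}]| = (2 ^ n)%N.
    by rewrite cardsT card_ffun card_bool card_ord.
  rewrite -(card_imset _ injf) -card_bool -cardsT -cardsX.
  apply: subset_leq_card; apply/subsetP=> _ /imsetP[x _ ->].
  by rewrite !inE; have := inA x; rewrite negbK.
exists (prism_tightened n_gt1 x); split; first exact: quasi_graphic_any.
  exact: prism_tightened_not_frame.
move=> X XA; apply: rank_tighten.
by apply: contraNneq xA => <-.
Qed.
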